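(* Let $M=\mathcal{M}^0(G,n,m;P)$ be a finite regular Rees matrix semigroup with sandwich matrix $P$. If $M$ is not CS-diagonal, then $M/\eta^{*}=\{\theta\}$ (the one-element semigroup). Otherwise $M/\eta^{*}\cong\mathcal{M}^0(G_{\eta^{*}},n_{\eta^{*}},n_{\eta^{*}};I_{n_{\eta^{*}}})$, where $I_{n_{\eta^*}}$ is the identity matrix.
   Context: For a semigroup $S$, $S^1$ denotes $S$ if $S$ has an identity, and $S$ with an identity $1$ adjoined otherwise. For $x,y,z_1,z_2,\ldots$ in $S^1$ define recursively $\lambda_0=x$, $\rho_0=y$, and $\lambda_{n+1}=\lambda_n z_{n+1}\rho_n$, $\rho_{n+1}=\rho_n z_{n+1}\lambda_n$, where $\lambda_n=\lambda_n(x,y,z_1,\ldots,z_n)$ and $\rho_n=\rho_n(x,y,z_1,\ldots,z_n)$. For a semigroup $S$ let $\eta_1=\{(x,x)\mid x\in S\}$ and, for every integer $n>1$, let $x\,\eta_n\,y$ if and only if there exist $z_1,\ldots,z_n\in S^1$ such that $x=\lambda_n(x,y,z_1,\ldots,z_n)$ and $y=\rho_n(x,y,z_1,\ldots,z_n)$. Let $\eta$ be the transitive closure of $\bigcup_{i\ge 1}\eta_i$, and let $\eta^{*}$ be the smallest congruence on $S$ containing $\eta$. Rees matrix semigroups: $G$ is a finite group, $n,m$ are positive integers, $P=(p_{ji})$ is an $m\times n$ matrix with entries in $G\cup\{\theta\}$. The nonzero elements of $\mathcal{M}^0(G,n,m;P)$ are the triples $(g;i,j)$ with $g\in G$, $1\le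 i\le n$, $1\le j\le m$; the zero is $\theta$; the product is $(g;i,j)(h;k,l)=(g p_{jk} h;i,l)$ if $p_{jk}\ne\theta$ and $\theta$ otherwise. It is regular if every row and every column of $P$ contains a nonzero entry. $M=\mathcal{M}^0(G,n,m;P)$ (finite, regular) is CS-diagonal if for all $1\le r,r'\le m$, $1\le t,t'\le n$: whenever $p_{r,t},p_{r',t},p_{r,t'}$ are nonzero, $p_{r',t'}$ is nonzero. For CS-diagonal $M$, the relation ''$i_\alpha,i_\beta\in\{1,\ldots,n\}$ are equivalent iff there is $1\le j\le m$ with $p_{j,i_\alpha}$ and $p_{j,i_\beta}$ nonzero'' is an equivalence relation on $\{1,\ldots,n\}$; its number of classes is denoted $n_{\eta^{*}}$, its classes $\mathbb{I}_1,\ldots,\mathbb{I}_{n_{\eta^{*}}}$, and $\mathbb{I}'_l=\{j : p_{j,i}\neq\theta \text{ for some } i\in\mathbb{I}_l\}$. The sets $\mathbb{I}'_1,\ldots,\mathbb{I}'_{n_{\eta^*}}$ partition $\{1,\ldots,m\}$, and $p_{j,i}\ne\theta$ for $i\in\mathbb{I}_g$, $j\in\mathbb{I}'_h$ if and only if $g=h$. For CS-diagonal $M$, $G/\eta^{*}$ is the quotient of the group $G$ by its own relation $\eta^{*}$ ($G$ regarded as a semigroup), and $G_{\eta^{*}}=(G/\eta^{*})/K$, where $K$ is the smallest normal subgroup of $G/\eta^{*}$ such that, for all $1\le a,b\le n_{\eta^{*}}$, the images in $(G/\eta^* )/K$ of the entries of $P$ satisfy $$p_{x,c'}^{-1}p_{x,c}=p_{\beta,c'}^{-1}p_{\beta,c}\quad\text{and}\quad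 p_{d,y}p_{d',y}^{-1}=p_{d,\alpha}p_{d',\alpha}^{-1}$$ for all $c,c'\in\mathbb{I}_a$, $\beta,x\in\mathbb{I}'_a$, $\alpha,y\in\mathbb{I}_b$, $d,d'\in\mathbb{I}'_b$. *)

(* Defs.v *)
From HB Require Import structures.
From mathcomp Require Import all_boot all_order all_algebra all_fingroup.
From mathcomp Require Import boolp.
From Stdlib Require Relation_Definitions Relation_Operators.

Set Implicit Arguments.
Unset Strict Implicit.
Unset Printing Implicit Defensive.

Local Open Scope group_scope.
Local Open Scope quotient_scope.

Local Notation qrepr := generic_quotient.repr.


Definition has_identity (S : semigroupType) : Prop :=
  exists e : S, forall x : S, e * x = x /\ x * e = x.

(* [S] with a new identity [None] adjoined, whether or not [S] already has
   one; see [in_S1] for S^1. *)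
Definition adjoin1 (S : semigroupType) : Type := option S.

Section Adjoin1.
Variable S : semigroupType.

Definition adjoin1_mul (a b : adjoin1 S) : adjoin1 S :=
  match a, b with
  | None, _ => b
  | _, None => a
  | Some x, Some y => Some (x * y)
  end.

Lemma adjoin1_mulA : associative adjoin1_mul.
Proof. by case=> [x|] [y|] [z|] //=; rewrite mulgA. Qed.

HB.instance Definition _ := Choice.copy (adjoin1 S) (option S).
HB.instance Definition _ := isSemigroup.Build (adjoin1 S) adjoin1_mulA.

End Adjoin1.

(* S^1 as a subsemigroup of [adjoin1 S]: the adjoined identity is allowed only
   when [S] has no identity of its own. *)
Definition in_S1 (S : semigroupType) (z : adjoin1 S) : Prop :=
  z = None -> ~ has_identity S.

(* The pair (lambda_n, rho_n) at (x, y, z_1, ..., z_n). *)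
Definition lambda_rho (T : semigroupType) (x y : T) (zs : seq T) : T * T :=
  foldl (fun p z => (p.1 * z * p.2, p.2 * z * p.1)) (x, y) zs.

(* Only used for n >= 1; n = 1 is equality by convention. *)
Definition eta_n (S : semigroupType) (n : nat) (x y : S) : Prop :=
  if n is 1 then x = y
  else exists z : n.-tuple (adjoin1 S),
    (forall i, in_S1 (tnth z i)) /\
    lambda_rho (Some x : adjoin1 S) (Some y) z = (Some x, Some y).

Definition eta (S : semigroupType) : S -> S -> Prop :=
  Relation_Operators.clos_trans S (fun x y => exists n, (1 <= n)%N /\ eta_n n x y).

Definition congruence (S : semigroupType) (R : S -> S -> Prop) : Prop :=
  Relation_Definitions.equivalence S R /\
  forall a b c : S, R a b -> R (c * a) (c * b) /\ R (a * c) (b * c).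

Definition eta_star (S : semigroupType) (x y : S) : Prop :=
  forall R : S -> S -> Prop,
    congruence R -> (forall a b, eta a b -> R a b) -> R x y.

Lemma eta_star_congruence (S : semigroupType) : congruence (@eta_star S).
Proof.
split; first split.
- by move=> x R [[r _ _] _] _; exact: r.
- by move=> x y z xy yz R cR eR; have [[_ t _] _] := cR; exact: t (xy _ cR eR) (yz _ cR eR).
- by move=> x y xy R cR eR; have [[_ _ s] _] := cR; exact: s (xy _ cR eR).
by move=> a b c ab; split=> R cR eR; have [_ m] := cR;
  have [] := m _ _ c (ab _ cR eR).
Qed.

Section EtaQuotient.
Variable S : semigroupType.

Definition eta_starb : rel S := fun x y => `[< eta_star x y >].

Lemma eta_starb_refl : reflexive eta_starb.
Proof. by move=> x; apply/asboolP; have [[r _ _] _] := eta_star_congruence S; exact: r. Qed.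

Lemma eta_starb_sym : symmetric eta_starb.
Proof.
have [[_ _ s] _] := eta_star_congruence S.
by move=> x y; apply/asboolP/asboolP; exact: s.
Qed.

Lemma eta_starb_trans : transitive eta_starb.
Proof.
have [[_ t _] _] := eta_star_congruence S.
by move=> y x z /asboolP xy /asboolP yz; apply/asboolP; exact: t xy yz.
Qed.

Canonical eta_star_equiv :=
  EquivRel eta_starb eta_starb_refl eta_starb_sym eta_starb_trans.

(* The quotient semigroup S / eta^*. *)
Definition eta_quot : Type := {eq_quot eta_star_equiv}.

HB.instance Definition _ := Choice.on eta_quot.
HB.instance Definition _ := EqQuotient.on eta_quot.

Definition eta_quot_mul (a b : eta_quot) : eta_quot :=
  \pi_eta_quot (qrepr a * qrepr b).

Lemma pi_eta_starP (x y : S) : \pi_eta_quot x = \pi_eta_quot y <-> eta_star x y.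
Proof.
split=> [/eqquotP/asboolP //|xy].
by apply/eqquotP/asboolP.
Qed.

Lemma pi_eta_mul (x y : S) :
  eta_quot_mul (\pi_eta_quot x) (\pi_eta_quot y) = \pi_eta_quot (x * y).
Proof.
have [[_ t _] m] := eta_star_congruence S.
apply/pi_eta_starP.
have ex : eta_star (qrepr (\pi_eta_quot x)) x by apply/pi_eta_starP; rewrite reprK.
have ey : eta_star (qrepr (\pi_eta_quot y)) y by apply/pi_eta_starP; rewrite reprK.
by apply: t (m _ _ _ ex).2 (m _ _ _ ey).1.
Qed.

Lemma eta_quot_mulA : associative eta_quot_mul.
Proof.
elim/quotW=> x; elim/quotW=> y; elim/quotW=> z.
by rewrite (pi_eta_mul y z) (pi_eta_mul x y) !(pi_eta_mul x, pi_eta_mul (x * y)) mulgA.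
Qed.

HB.instance Definition _ := isSemigroup.Build eta_quot eta_quot_mulA.

End EtaQuotient.

(* For a finite group, G / eta^* with the same product is a finite group; the
   separate name carries the [finGroupType] structure. *)
Definition eta_group (gT : finGroupType) : Type := eta_quot gT.

Definition to_eta_group (gT : finGroupType) (g : gT) : eta_group gT :=
  \pi_(eta_quot gT) g.

Section EtaGroup.
Variable gT : finGroupType.
Local Notation Q := (eta_group gT).

Definition eta_group_mul : Q -> Q -> Q := @eta_quot_mul gT.
Definition eta_group_one : Q := to_eta_group 1.
Definition eta_group_repr (a : Q) : gT := qrepr (a : eta_quot gT).
Definition eta_group_inv (a : Q) : Q := to_eta_group (eta_group_repr a)^-1.

Lemma eta_group_reprK : cancel eta_group_repr (@to_eta_group gT).
Proof. by move=> a; exact: (@generic_quotient.reprK _ (eta_quot gT)). Qed.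

Lemma eta_group_mulA : associative eta_group_mul.
Proof. exact: eta_quot_mulA. Qed.

Lemma eta_group_mul1 : left_id eta_group_one eta_group_mul.
Proof. by elim/quotW=> x; rewrite [LHS]pi_eta_mul mul1g. Qed.

Lemma eta_group_mulV : left_inverse eta_group_one eta_group_inv eta_group_mul.
Proof.
move=> a; rewrite -{2}[a]eta_group_reprK.
by rewrite [LHS]pi_eta_mul mulVg.
Qed.

HB.instance Definition _ := Finite.copy Q (can_type eta_group_reprK).
HB.instance Definition _ := Finite_isGroup.Build Q
  eta_group_mulA eta_group_mul1 eta_group_mulV.

End EtaGroup.

(* M^0(G, n, m; P), with zero [None]; the entries of [P] lie in G u {theta},
   theta being [None]. *)
Definition rees0 (gT : finGroupType) (n m : nat) (P : 'M[option gT]_(m, n)) :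
  Type := option (gT * 'I_n * 'I_m).

Section Rees.
Variables (gT : finGroupType) (n m : nat) (P : 'M[option gT]_(m, n)).

Definition rees0_mul (a b : rees0 P) : rees0 P :=
  match a, b with
  | Some (g, i, j), Some (h, k, l) =>
      if P j k is Some p then Some (g * p * h, i, l) else None
  | _, _ => None
  end.

Lemma rees0_mulA : associative rees0_mul.
Proof.
case=> [[[g i] j]|] [[[h k] l]|] [[[f r] s]|] //=.
- case E: (P l r) => [q|]; case F: (P j k) => [p|] //=; rewrite ?E ?F //.
  by rewrite !mulgA.
- by case: (P j k).
Qed.

HB.instance Definition _ := Finite.copy (rees0 P) (option (gT * 'I_n * 'I_m)).
HB.instance Definition _ := isSemigroup.Build (rees0 P) rees0_mulA.

Definition rees_zero : rees0 P := None.

Definition rees_regular : Prop :=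
  (forall j, exists i, P j i != None) /\ (forall i, exists j, P j i != None).

Definition CS_diagonal : Prop :=
  forall (r r' : 'I_m) (t t' : 'I_n),
    P r t != None -> P r' t != None -> P r t' != None -> P r' t' != None.

Definition col_equiv : rel 'I_n :=
  fun i i' => [exists j, (P j i != None) && (P j i' != None)].

(* The classes I_1, ..., I_{n_eta*}. *)
Definition col_classes : {set {set 'I_n}} :=
  equivalence_partition col_equiv [set: 'I_n].

Lemma col_equivP : rees_regular -> CS_diagonal ->
  {in [set: 'I_n] & &, equivalence_rel col_equiv}.
Proof.
case=> _ reg cs i k l _ _ _; split.
  by have [j Pj] := reg l; apply/existsP; exists j; apply/andP.
case/existsP=> j /andP[ji jk]; apply/existsP/existsP => -[j' /andP[j'i j'l]].
  by exists j'; rewrite j'l andbT; exact: cs ji j'i jk.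
by exists j'; rewrite j'l andbT; exact: cs jk j'i ji.
Qed.

Definition n_eta_star : nat := #|col_classes|.

(* I'_l for I_l = A. *)
Definition row_class (A : {set 'I_n}) : {set 'I_m} :=
  [set j | [exists i in A, P j i != None]].

(* Image in (G / eta^* ) / N of the entry p_{j,i}; the value at theta is
   irrelevant, being used only for i in I_a and j in I'_a. *)
Definition entry_img (N : {group eta_group gT}) (j : 'I_m) (i : 'I_n) :
  coset_of N := coset N (to_eta_group (odflt 1 (P j i))).

Definition entry_relations (N : {group eta_group gT}) : Prop :=
  let p := entry_img N in
  forall A B, A \in col_classes -> B \in col_classes ->
    (forall c c' beta x, c \in A -> c' \in A ->
       beta \in row_class A -> x \in row_class A ->
       (p x c')^-1 * p x c = (p beta c')^-1 * p beta c) /\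
    (forall alpha y d d', alpha \in B -> y \in B ->
       d \in row_class B -> d' \in row_class B ->
       p d y * (p d' y)^-1 = p d alpha * (p d' alpha)^-1).

(* The smallest normal subgroup K; see [Keta_smallest]. *)
Definition Keta : {group eta_group gT} :=
  (\bigcap_(N : {group eta_group gT} |
      (N <| [set: eta_group gT]) && `[< entry_relations N >]) N)%G.

Lemma coset_memP (N : {group eta_group gT}) (a b : eta_group gT) :
  N <| [set: eta_group gT] -> coset N a = coset N b <-> a * b^-1 \in N.
Proof.
case/andP=> _ /subsetP nN.
have nx x : x \in 'N(N) by apply: nN; rewrite inE.
split=> [e|abN].
  by apply: coset_idr => //; rewrite morphM ?morphV //= e mulgV.
by apply/eqP; rewrite eq_mulgV1 -morphV // -morphM //; apply/eqP/coset_id.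
Qed.

Lemma Keta_smallest :
  [/\ Keta <| [set: eta_group gT], entry_relations Keta
    & forall N : {group eta_group gT},
        N <| [set: eta_group gT] -> entry_relations N -> Keta \subset N].
Proof.
have nK : Keta <| [set: eta_group gT].
  rewrite /normal subsetT /=; apply: norms_bigcap; apply/bigcapsP=> N.
  by case/andP => /andP[].
have morN (N : {group eta_group gT}) : N <| [set: eta_group gT] ->
    (forall a b, coset N a * coset N b = coset N (a * b)) /\
    (forall a, (coset N a)^-1 = coset N a^-1).
  case/andP=> _ /subsetP nN.
  have nx x : x \in 'N(N) by apply: nN; rewrite inE.
  by split=> *; rewrite ?morphM ?morphV.
split=> //; last first.
  by move=> N nN rN; apply: bigcap_inf; rewrite nN; apply/asboolP.
move=> A B hA hB; have [KM KV] := morN _ nK.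
split=> [c c' beta x hc hc' hb hx|alpha y d d' ha hy hd hd'];
  rewrite /entry_img !KV !KM; apply/(coset_memP _ _ nK)/bigcapP => N;
  case/andP=> nN /asboolP rN; apply/(coset_memP _ _ nN);
  have [NM NV] := morN _ nN; rewrite -!NM -!NV;
  have [r1 r2] := rN A B hA hB; [exact: r1 | exact: r2].
Qed.

Definition G_eta_star : finGroupType := coset_of Keta.

End Rees.

(* The identity matrix, with theta off the diagonal. *)
Definition id_sandwich (gT : finGroupType) (k : nat) : 'M[option gT]_(k, k) :=
  \matrix_(j, i) (if j == i then Some 1%g else None).

Definition semigroup_iso (S T : semigroupType) : Prop :=
  exists f : {multiplicative S -> T}, bijective f.

(* Main.v *)
From HB Require Import structures.
Require Import Defs.
From mathcomp Require Import all_boot all_order all_algebra all_fingroup.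
From mathcomp Require Import boolp.

(**
  Outside the CS-diagonal case, a right-zero pair of idempotents in one R-class
  is eta-related, and right multiplication by a suitable element kills exactly
  one of the two; so a nonzero element is congruent to zero, hence all are.

  In the CS-diagonal case, the relations defining K say exactly that the images
  of the entries factor as v_j u_i, so (g; i, j) |-> (u_i g v_j; [i], [j]) is a
  surjective morphism onto the Rees semigroup over the identity matrix.
  It identifies eta*-related elements because eta is trivial on the target: a
  solution of x = lambda_n, y = rho_n there lives in one H-class, hence gives a
  solution in G_eta*, which lifts to an eta-related pair of the finite group G.
  Conversely, the elements a of G with (a g; i, j) eta* (g; i, j) for all g, i,
  j form a normal subgroup whose image satisfies the relations defining K; so it
  contains K, and elements with equal images are eta*-related.
*)

Set Implicit Arguments.
Unset Strict Implicit.
Unset Printing Implicit Defensive.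

Local Open Scope group_scope.

(** * The recursion for lambda and rho, and elementary related pairs *)

Lemma lambda_rho_map (S T : semigroupType) (f : S -> T) (x y : S) zs :
  {morph f : a b / a * b} ->
  lambda_rho (f x) (f y) (map f zs) =
  (f (lambda_rho x y zs).1, f (lambda_rho x y zs).2).
Proof.
move=> fM; rewrite /lambda_rho; elim: zs x y => [//|z zs IH] x y /=.
by rewrite -!fM IH.
Qed.

Lemma omap_adjoin1M (S T : semigroupType) (f : S -> T) :
  {morph f : a b / a * b} ->
  {morph (omap f : adjoin1 S -> adjoin1 T) : a b / a * b}.
Proof. by move=> fM [a|] [b|] //; congr Some; exact: fM. Qed.

Lemma eta_nE (S : semigroupType) n (x y : S) : (1 < n)%N ->
  eta_n n x y <-> exists z : n.-tuple (adjoin1 S),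
    (forall i, in_S1 (tnth z i)) /\
    lambda_rho (Some x : adjoin1 S) (Some y) z = (Some x, Some y).
Proof. by case: n => [|[|n]]. Qed.

Lemma eta_lambda_rho (S : semigroupType) (x y : S) (zs : seq S) :
  (1 < size zs)%N -> lambda_rho x y zs = (x, y) -> eta x y.
Proof.
move=> s1 e; apply: Relation_Operators.t_step; exists (size zs).
split; first exact: ltnW.
apply/eta_nE => //; exists (map_tuple Some (in_tuple zs)).
split=> [i|]; first by rewrite tnth_map.
by rewrite (@lambda_rho_map S (adjoin1 S) Some) // e.
Qed.

(** The letter [x] swaps the pair: [x * x * y = y] and [y * x * x = x]. Using it twice restores the
    pair. *)
Lemma eta_right_zero (S : semigroupType) (x y : S) :
  x * y = y -> y * x = x -> eta x y.
Proof.
move=> xy yx; have xx : x * x = x by rewrite -{2}yx mulgA xy.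
by apply: (@eta_lambda_rho _ _ _ [:: x; x]) => //=; rewrite /lambda_rho /= !(xx, xy, yx).
Qed.

(** One letter [x] already fixes the pair. It is repeated because the relation of index 1 is
    equality by convention. *)
Lemma eta_left_zero (S : semigroupType) (x y : S) :
  x * y = x -> y * x = y -> eta x y.
Proof.
move=> xy yx; have xx : x * x = x by rewrite -{1}xy -mulgA yx.
by apply: (@eta_lambda_rho _ _ _ [:: x; x]) => //=; rewrite /lambda_rho /= !(xx, xy, yx).
Qed.

(** * Congruence rules for [eta_star] and its behaviour under morphisms *)

Section EtaStar.
Variable S : semigroupType.
Implicit Types x y z : S.

Lemma eta_sub_star x y : eta x y -> eta_star x y.
Proof. by move=> xy R _; apply. Qed.

Lemma eta_star_refl x : eta_star x x.
Proof. by have [[r _ _] _] := eta_star_congruence S; exact: r. Qed.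

Lemma eta_star_sym x y : eta_star x y -> eta_star y x.
Proof. by have [[_ _ s] _] := eta_star_congruence S; exact: s. Qed.

Lemma eta_star_trans y x z : eta_star x y -> eta_star y z -> eta_star x z.
Proof. by have [[_ t _] _] := eta_star_congruence S; exact: t. Qed.

Lemma eta_star_mull z x y : eta_star x y -> eta_star (z * x) (z * y).
Proof. by have [_ m] := eta_star_congruence S => /(m _ _ z)[]. Qed.

Lemma eta_star_mulr z x y : eta_star x y -> eta_star (x * z) (y * z).
Proof. by have [_ m] := eta_star_congruence S => /(m _ _ z)[]. Qed.

End EtaStar.

(** An identity in [S] excludes [None] as a letter, so the letters map into [T] itself and are
    admissible whether or not [T] has an identity. *)
Lemma eta_star_morph (S T : semigroupType) (f : S -> T) x y :
  has_identity S -> {morph f : a b / a * b} ->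
  eta_star x y -> eta_star (f x) (f y).
Proof.
move=> S1 fM xy; apply: (xy (fun a b => eta_star (f a) (f b))) => [|a b].
  split; first split.
  - by move=> a; exact: eta_star_refl.
  - by move=> a b c; exact: eta_star_trans.
  - by move=> a b; exact: eta_star_sym.
  by move=> a b c ab; rewrite !fM; split; [exact: eta_star_mull|exact: eta_star_mulr].
elim=> {a b} [a b [n [n0 nab]]|a b c _ ab _ bc]; last exact: eta_star_trans bc.
apply: eta_sub_star; apply: Relation_Operators.t_step; exists n; split=> //.
case: n n0 nab => [|[|n]] // _; first by move->.
case=> z [z1 e]; exists (map_tuple (omap f) z); split=> [i|].
  by rewrite tnth_map; have := z1 i; case: (tnth z i) => //= /(_ erefl).
have f1M := omap_adjoin1M fM.
by rewrite (@lambda_rho_map (adjoin1 S) (adjoin1 T) _ (Some a) (Some b) z f1M) e.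
Qed.

Lemma eta_star_morph_eq (S T : semigroupType) (f : S -> T) :
  {morph f : a b / a * b} -> (forall x y, eta x y -> f x = f y) ->
  forall x y, eta_star x y -> f x = f y.
Proof.
move=> fM fe x y xy; apply: (xy (fun a b => f a = f b)) => //; split.
  by split=> [a|a b c -> ->|a b ->].
by move=> a b c ab; rewrite !fM ab.
Qed.

(* In the finite set G x G some iterate of the map (x, y) |-> (lambda, rho) is
   periodic, and all iterates lift the fixed pair (x, y) below. *)
Lemma eta_lift (G H : finGroupType) (f : G -> H) (x y : H) zs :
  {morph f : a b / a * b} -> (forall h, exists g, f g = h) ->
  (1 < size zs)%N -> lambda_rho x y zs = (x, y) ->
  exists x' y', [/\ f x' = x, f y' = y & eta x' y'].
Proof.
move=> fM fS s1 fxy.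
have [x0 x0E] := fS x; have [y0 y0E] := fS y.
have [ws wsE] : exists ws, map f ws = zs.
  elim: zs {s1 fxy} => [|z zs [ws <-]]; first by exists [::].
  by have [w <-] := fS z; exists (w :: ws).
have ws1 : (1 < size ws)%N by rewrite -wsE size_map in s1.
pose Phi (p : G * G) := lambda_rho p.1 p.2 ws.
have PhiE t p : iter t Phi p = lambda_rho p.1 p.2 (flatten (nseq t ws)).
  elim: t p => [[]//|t IH] p; rewrite iterSr IH /= /Phi /lambda_rho foldl_cat.
  by case: p => a b /=; rewrite -surjective_pairing.
have PhiF t : (f (iter t Phi (x0, y0)).1, f (iter t Phi (x0, y0)).2) = (x, y).
  elim: t => [|t [ex ey]] /=; first by rewrite x0E y0E.
  by rewrite -lambda_rho_map // ex ey wsE.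
have /trajectP[i lti e] := looping_order Phi (x0, y0).
have [ex ey] := PhiF i; set p := iter i _ _ in e ex ey.
exists p.1, p.2; split=> //.
(* After [order] steps the orbit is back at its [i]-th point [p]. So [d] is a period of [p], and
   [ws] repeated [d] times fixes the pair. *)
pose d := (fingraph.order Phi (x0, y0) - i)%N.
have d0 : (0 < d)%N by rewrite subn_gt0.
apply: (@eta_lambda_rho _ _ _ (flatten (nseq d ws))).
  rewrite -(prednK d0) /= size_cat; exact: leq_trans (leq_addr _ _).
by rewrite -PhiE /p -iterD subnK ?(ltnW lti) // e -surjective_pairing.
Qed.

(** * Solutions of the recursion over the identity sandwich matrix *)

Section IdSandwich.
Variables (H : finGroupType) (k : nat).
Local Notation T := (rees0 (id_sandwich H k)).
Local Notation T1 := (adjoin1 T).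
Local Notation zero := (Some (None : T) : T1).
Local Notation tr g i j := (Some (Some (g, i, j) : T) : T1).

Lemma id_sandwich_mul (g h : H) (i j i' j' : 'I_k) :
  (Some (g, i, j) : T) * Some (h, i', j') =
  if j == i' then Some (g * h, i, j') else None.
Proof.
transitivity (rees0_mul (Some (g, i, j) : T) (Some (h, i', j'))); first by [].
by rewrite /= mxE; case: eqP => // _; rewrite mulg1.
Qed.

Lemma adjoin1_zerol (z : T1) : zero * z = zero.
Proof. by case: z => [[[[]]|]|]. Qed.

Lemma adjoin1_zeror (z : T1) : z * zero = zero.
Proof. by case: z => [[[[]]|]|]. Qed.

(** Zero propagates. By contraposition, a final pair of nonzero elements forces both components to
    be nonzero at every stage. *)
Lemma lambda_rho_zero (x y : T1) zs : (x == zero) || (y == zero) ->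
  ((lambda_rho x y zs).1 == zero) || ((lambda_rho x y zs).2 == zero).
Proof.
elim: zs x y => [//|z zs IH] x y e; apply: IH => /=.
by case/orP: e => /eqP->; rewrite ?adjoin1_zerol ?adjoin1_zeror ?adjoin1_zerol ?eqxx ?orbT.
Qed.

Lemma lambda_rho_zero_pair zs : lambda_rho zero zero zs = (zero, zero).
Proof. by elim: zs => [//|z zs IH]; rewrite /lambda_rho /= !adjoin1_zeror; exact: IH. Qed.

Lemma adjoin1_mul_tr (g h : H) (i j i' j' : 'I_k) :
  tr g i j * tr h i' j' = if j == i' then tr (g * h) i j' else zero.
Proof.
change (Some ((Some (g, i, j) : T) * (Some (h, i', j') : T)) =
  if j == i' then tr (g * h) i j' else zero).
by rewrite id_sandwich_mul; case: eqP.
Qed.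

Lemma adjoin1_mul3 (g h : H) i j i' j' (z : T1) :
  tr g i j * z * tr h i' j' != zero ->
  (z = None /\ j = i') \/ exists w, z = tr w j i'.
Proof.
case: z => [[[[w a] b]|]|] => [|//|].
  rewrite adjoin1_mul_tr; case: (j =P a) => [<-|_ /eqP//] e.
  right; exists w; move: e.
  by rewrite adjoin1_mul_tr; case: (b =P i') => [<-|_ /eqP].
change (tr g i j * None) with (tr g i j).
by rewrite adjoin1_mul_tr; case: (j =P i') => [<-|_ /eqP//] _; left.
Qed.

(** By [adjoin1_mul3] each letter keeps the pair in its H-class, so the group components follow the
    same recursion in [H]. An adjoined identity contributes the letter 1. *)
Lemma lambda_rho_hom_group (g h g' h' : H) (i j i' j' : 'I_k) zs :
  lambda_rho (tr g i j) (tr h i j) zs = (tr g' i' j', tr h' i' j') ->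
  exists ws, size ws = size zs /\ lambda_rho g h ws = (g', h').
Proof.
elim: zs g h => [|z zs IH] g h e; first by exists [::]; case: e => -> _ _ ->.
have e' : lambda_rho (tr g i j * z * tr h i j) (tr h i j * z * tr g i j) zs =
    (tr g' i' j', tr h' i' j') := e.
have nz : (tr g i j * z * tr h i j != zero) /\ (tr h i j * z * tr g i j != zero).
  by split; apply/negP => z0;
    have := @lambda_rho_zero (tr g i j * z * tr h i j) (tr h i j * z * tr g i j) zs;
    rewrite e' z0 ?orbT => /(_ isT).
have [w [gE hE]] : exists w, tr g i j * z * tr h i j = tr (g * w * h) i j /\
    tr h i j * z * tr g i j = tr (h * w * g) i j.
  case/adjoin1_mul3: (nz.1) => [[-> ji]|[w ->]].
    exists 1; rewrite !mulg1.
    change (tr g i j * tr h i j = tr (g * h) i j /\ tr h i j * tr g i j = tr (h * g) i j).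
    by rewrite !adjoin1_mul_tr ji eqxx.
  by exists w; rewrite !(adjoin1_mul_tr, eqxx).
rewrite gE hE in e'; have [ws [sz ewsE]] := IH _ _ e'.
by exists (w :: ws); rewrite /= sz.
Qed.

(** If a zero occurs before the last letter, the pair ends as zero and zero. Otherwise the first two
    letters force [x] and [y] into one H-class, and the problem descends to [H]. The words range
    over all of [adjoin1], since the image of an admissible letter need not be admissible. *)
Lemma id_sandwich_lambda_rho (x y : T) (zs : seq T1) :
  (forall (g h : H) ws,
    (1 < size ws)%N -> lambda_rho g h ws = (g, h) -> g = h) ->
  (1 < size zs)%N -> lambda_rho (Some x : T1) (Some y) zs = (Some x, Some y) ->
  x = y.
Proof.
move=> Htriv s1 e.
case: zs s1 e => [//|z1 [//|z2 zs]] s1 e.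
have zero_step (a b : T1) zs' : (a == zero) || (b == zero) -> (0 < size zs')%N ->
    lambda_rho a b zs' = (Some x, Some y) -> x = y.
  case: zs' => [//|z zs'] ab _; rewrite /lambda_rho /=.
  have -> : a * z * b = zero.
    by case/orP: ab => /eqP->; rewrite ?adjoin1_zerol ?adjoin1_zeror.
  have -> : b * z * a = zero.
    by case/orP: ab => /eqP->; rewrite ?adjoin1_zerol ?adjoin1_zeror.
  by rewrite -/(lambda_rho zero zero zs') lambda_rho_zero_pair => -[<- <-].
have [xy0|] := boolP (((Some x : T1) == zero) || ((Some y : T1) == zero)).
  exact: zero_step xy0 _ e.
case: x e zero_step => [[[g i] j]|] // e zero_step.
case: y e zero_step => [[[h k'] l]|] // e zero_step _.
set a := tr g i j * z1 * tr h k' l.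
set b := tr h k' l * z1 * tr g i j.
have e1 : lambda_rho a b (z2 :: zs) = (tr g i j, tr h k' l) := e.
have [ab0|] := boolP ((a == zero) || (b == zero)); first exact: zero_step ab0 _ e1.
rewrite negb_or => /andP[a0 b0].
have [ik jl] : i = k' /\ j = l.
  case/adjoin1_mul3: (a0) => [[z1E jk]|[w z1E]]; last first.
    by move: b0; rewrite /b z1E; case/adjoin1_mul3 => [[//]|[w' [_ -> ->]]].
  (* With [z1] the adjoined identity, one only gets [j = k'] and [l = i]. Then [a] and [b] lie at
     positions [(i, i)] and [(j, j)], and the second letter [z2] forces [i = j]. *)
  case/adjoin1_mul3: (b0) => [[_ li]|[w z1E']]; last by rewrite z1E' in z1E.
  have aE : a = tr (g * h) i i.
    by rewrite /a z1E jk -[RHS]/(tr (g * h) i i) li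
       -[X in X * _]/(tr g i k') adjoin1_mul_tr eqxx.
  have bE : b = tr (h * g) j j.
    by rewrite /b z1E li jk -[X in X * _]/(tr h k' i) adjoin1_mul_tr eqxx.
  have e2 : lambda_rho (a * z2 * b) (b * z2 * a) zs = (tr g i j, tr h k' l) := e.
  have := @lambda_rho_zero (a * z2 * b) (b * z2 * a) zs; rewrite e2 /= => nz.
  have [a20 b20] : a * z2 * b != zero /\ b * z2 * a != zero.
    by split; apply/negP => z0; move: nz; rewrite z0 ?orbT => /(_ isT).
  rewrite aE bE in a20 b20.
  case/adjoin1_mul3: a20 => [[_ ij]|[w z2E]]; first by rewrite -jk li ij.
  by move: b20; rewrite z2E => /adjoin1_mul3[[//]|[w' [_ ji _]]]; rewrite -jk li ji.
rewrite -ik -jl in e *.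
have [ws [sz ews]] := lambda_rho_hom_group e.
by rewrite (Htriv _ _ _ _ ews) ?sz // ik jl.
Qed.

End IdSandwich.

(** * The homomorphism theorem for [eta_quot], and the projection to [eta_group] *)

Lemma eta_quot_iso (S T : semigroupType) (f : S -> T) :
  {morph f : a b / a * b} -> (forall t, exists s, f s = t) ->
  (forall x y, eta_star x y -> f x = f y) ->
  (forall x y, f x = f y -> eta_star x y) -> semigroup_iso (eta_quot S) T.
Proof.
move=> fM fS sub sup.
pose F (q : eta_quot S) : T := f (generic_quotient.repr q).
have FE x : F (\pi_(eta_quot S) x)%qT = f x.
  by apply: sub; apply/pi_eta_starP; rewrite generic_quotient.reprK.
have FM : {morph F : a b / a * b} by move=> a b; rewrite FE fM.
pose Fm : {multiplicative eta_quot S -> T} :=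
  HB.pack F (isMultiplicative.Build _ _ F FM).
exists Fm; have [g gK] := choice fS.
exists (fun t => (\pi_(eta_quot S) (g t))%qT) => [q|t]; last by rewrite [LHS]FE gK.
rewrite -[RHS]generic_quotient.reprK; apply/pi_eta_starP; apply: sup; exact: gK.
Qed.

(* A plain [case] on such an equation over a coset type also unfolds the product
   of cosets. *)
Lemma Some_triple_inj (A B C : Type) (a a' : A) (b b' : B) (c c' : C) :
  Some (a, b, c) = Some (a', b', c') -> [/\ a = a', b = b' & c = c'].
Proof. by case=> -> -> ->. Qed.

Lemma to_eta_groupM (gT : finGroupType) : {morph @to_eta_group gT : a b / a * b}.
Proof. by move=> a b; rewrite [RHS]pi_eta_mul. Qed.

Lemma to_eta_groupV (gT : finGroupType) (a : gT) :
  to_eta_group a^-1 = (to_eta_group a)^-1.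
Proof. by apply: (mulgI (to_eta_group a)); rewrite mulgV -to_eta_groupM mulgV. Qed.

(** * Idempotents of the Rees semigroup and the collapse to zero *)

Section Rees.
Variables (gT : finGroupType) (n m : nat) (P : 'M[option gT]_(m, n)).
Local Notation M := (rees0 P).
Local Notation tr g i j := (Some (g, i, j) : M).
Hypothesis reg : rees_regular P.

Lemma rees0_mul_tr (g h : gT) i j k l :
  tr g i j * tr h k l = if P j k is Some p then tr (g * p * h) i l else None.
Proof. by []. Qed.

Lemma rees_pivot_row j : exists i p, P j i = Some p.
Proof. by have [i] := reg.1 j; case E: (P j i) => [p|//] _; exists i, p. Qed.

Lemma rees_pivot_col i : exists j p, P j i = Some p.
Proof. by have [j] := reg.2 i; case E: (P j i) => [p|//] _; exists j, p. Qed.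

Lemma eta_rees_row i j j' p p' : P j i = Some p -> P j' i = Some p' ->
  eta (tr p^-1 i j) (tr p'^-1 i j').
Proof.
by move=> Pj Pj'; apply: eta_right_zero; rewrite rees0_mul_tr ?Pj ?Pj' !mulVg mul1g.
Qed.

Lemma eta_rees_col i i' j p p' : P j i = Some p -> P j i' = Some p' ->
  eta (tr p^-1 i j) (tr p'^-1 i' j).
Proof.
by move=> Pj Pj'; apply: eta_left_zero; rewrite rees0_mul_tr ?Pj ?Pj' mulgK.
Qed.

(** Regularity supplies nonzero entries through which any given element is a two-sided multiple of
    [(g; i, j)]. *)
Lemma eta_star_rees_zero g i j : eta_star (tr g i j) None -> forall x : M, eta_star x None.
Proof.
move=> z0 [[[h k] l]|]; last exact: eta_star_refl.
have [b [p Pb]] := rees_pivot_col i; have [a [p' Pa]] := rees_pivot_row j.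
have := eta_star_mulr (tr 1 a l) (eta_star_mull (tr (h * (g * p')^-1 * p^-1) k b) z0).
by rewrite rees0_mul_tr Pb rees0_mul_tr Pa mulg1 mulgKV -mulgA mulgKV.
Qed.

Lemma eta_star_rees_not_CS : ~ CS_diagonal P -> forall x : M, eta_star x None.
Proof.
move=> nCS; have [r [r' [t [t' [rt r't rt' r't']]]]] : exists r r' t t',
  [/\ P r t != None, P r' t != None, P r t' != None & P r' t' = None].
  apply: contrapT => no; apply: nCS => r r' t t' rt r't rt'.
  by apply/eqP => r't'; apply: no; exists r, r', t, t'.
case Ert: (P r t) rt => [p|//] _; case Er't: (P r' t) r't => [p'|//] _.
case Ert': (P r t') rt' => [q|//] _.
(* The factor [(1; t', r)] meets the entry [q] in row [r] and theta in row [r']. *)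
have := eta_star_mulr (tr 1 t' r) (eta_sub_star (eta_rees_row Ert Er't)).
by rewrite !rees0_mul_tr Ert' r't'; exact: eta_star_rees_zero.
Qed.

(** The map sending [g] to [(g * p^-1; i, k)] embeds the group as a maximal subgroup. Right
    multiplication by [(1; i, j)] then moves the relation to [j]. *)
Lemma eta_star_rees_group a b i j : eta_star a b -> eta_star (tr a i j) (tr b i j).
Proof.
have [k [p Pk]] := rees_pivot_col i => ab.
have /(eta_star_mulr (tr 1 i j)) : eta_star (tr (a * p^-1) i k) (tr (b * p^-1) i k).
  apply: (@eta_star_morph gT M (fun g => tr (g * p^-1) i k)) ab.
    by exists 1 => x; rewrite mul1g mulg1.
  by move=> x y; rewrite rees0_mul_tr Pk !mulgA mulgKV.
by rewrite !rees0_mul_tr Pk !mulgKV !mulg1.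
Qed.

(** * A normal subgroup bounding [Keta] from above *)

Definition rees_trivial (a : gT) : Prop :=
  forall g i j, eta_star (tr (a * g) i j) (tr g i j).

Lemma rees_trivial_star a b : eta_star a b -> rees_trivial a -> rees_trivial b.
Proof.
move=> ab ta g i j; apply: eta_star_trans (ta g i j).
apply: eta_star_rees_group; apply: eta_star_mulr; exact: eta_star_sym.
Qed.

Lemma rees_trivialJ a b : rees_trivial a -> rees_trivial (a ^ b).
Proof.
move=> ta g i j; have [k [p Pk]] := rees_pivot_col i.
have := eta_star_mull (tr (b^-1 * p^-1) i k) (ta (b * g) i j).
by rewrite !rees0_mul_tr Pk mulgKV mulKg conjgE !mulgA.
Qed.

(** Membership is tested on a representative. By [rees_trivial_star] the choice is immaterial. *)
Definition Keta_bound_set : {set eta_group gT} :=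
  [set q | `[< rees_trivial (eta_group_repr q) >]].

Lemma Keta_bound_setP a : to_eta_group a \in Keta_bound_set <-> rees_trivial a.
Proof.
have e : eta_star (eta_group_repr (to_eta_group a)) a.
  by apply/pi_eta_starP; exact: eta_group_reprK.
rewrite inE; split=> [/asboolP|ta]; first exact: rees_trivial_star.
by apply/asboolP; apply: rees_trivial_star ta; exact: eta_star_sym.
Qed.

Lemma Keta_bound_group_set : group_set Keta_bound_set.
Proof.
apply/group_setP; split=> [|q r].
  apply/(Keta_bound_setP 1) => g i j; rewrite mul1g; exact: eta_star_refl.
rewrite -(eta_group_reprK q) -(eta_group_reprK r) -to_eta_groupM.
move=> /Keta_bound_setP tq /Keta_bound_setP tr0; apply/Keta_bound_setP => g i j.
rewrite -mulgA; exact: eta_star_trans (tq _ _ _) (tr0 _ _ _).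
Qed.

Canonical Keta_bound := Group Keta_bound_group_set.

Lemma Keta_bound_normal : Keta_bound <| [set: eta_group gT].
Proof.
rewrite /normal subsetT /=; apply/subsetP => x _; rewrite inE.
apply/subsetP => _ /imsetP[q qB ->]; move: qB.
rewrite -(eta_group_reprK q) -(eta_group_reprK x) => /Keta_bound_setP tq.
set a := eta_group_repr q; set b := eta_group_repr x.
have -> : to_eta_group a ^ to_eta_group b = to_eta_group (a ^ b).
  by rewrite !conjgE !to_eta_groupM to_eta_groupV.
by apply/Keta_bound_setP; exact: rees_trivialJ.
Qed.

Lemma coset_normalM (N : {group eta_group gT}) : N <| [set: eta_group gT] ->
  {morph coset N : a b / a * b}.
Proof.
by case/andP=> _ /subsetP nN a b; rewrite morphM ?nN ?inE.
Qed.

Lemma coset_normalV (N : {group eta_group gT}) : N <| [set: eta_group gT] ->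
  {morph coset N : a / a^-1}.
Proof.
by case/andP=> _ /subsetP nN a; rewrite morphV ?nN ?inE.
Qed.

(** The idempotents of rows [x] and [b] in the R-class of [c'] are related. Multiplying them on the
    right by an element with first index [c] produces the two quotients of entries, and a left
    factor then replaces [c'] by [i]. *)
Lemma rees_trivial_entries x b c c' p1 p2 p3 p4 :
  P x c = Some p1 -> P x c' = Some p2 -> P b c = Some p3 -> P b c' = Some p4 ->
  rees_trivial ((p2^-1 * p1) * (p4^-1 * p3)^-1).
Proof.
move=> Pxc Pxc' Pbc Pbc' g i j.
have := eta_star_mulr (tr ((p4^-1 * p3)^-1 * g) c j)
  (eta_sub_star (eta_rees_row Pxc' Pbc')).
rewrite !rees0_mul_tr Pxc Pbc mulKVg mulgA.
have [k [p Pk]] := rees_pivot_col c'.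
move/(eta_star_mull (tr p^-1 i k)).
by rewrite !rees0_mul_tr Pk mulVg !mul1g.
Qed.

(** * Blocks of a CS-diagonal matrix and the relations defining [Keta] *)

Hypothesis CS : CS_diagonal P.

Lemma mem_col_class (A : {set 'I_n}) : A \in col_classes P ->
  exists2 i, i \in A & A = [set k | col_equiv P i k].
Proof.
case/imsetP=> i _ ->; have AE : [set y in [set: 'I_n] | col_equiv P i y] =
  [set k | col_equiv P i k] by apply/setP => k; rewrite !inE.
exists i => //; rewrite AE inE.
by have /(_ i i i) := col_equivP reg CS; rewrite !inE => /(_ isT isT isT)[].
Qed.

Lemma col_class_of i : [set k | col_equiv P i k] \in col_classes P.
Proof.
by apply/imsetP; exists i; rewrite ?inE //; apply/setP => k; rewrite !inE.
Qed.

Lemma row_class_entry (A : {set 'I_n}) c x : A \in col_classes P ->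
  c \in A -> x \in row_class P A -> P x c != None.
Proof.
move=> /mem_col_class[i _ ->]; rewrite !inE.
move=> /existsP[j /andP[ji jc]] /existsP[l].
rewrite inE => /andP[/existsP[j' /andP[j'i j'l]] xl].
exact: CS j'l xl (CS ji j'i jc).
Qed.

Lemma Keta_bound_entries : entry_relations P Keta_bound.
Proof.
have nN := Keta_bound_normal.
have NM := coset_normalM nN; have NV := coset_normalV nN.
have rel A c c' beta x : A \in col_classes P -> c \in A -> c' \in A ->
    beta \in row_class P A -> x \in row_class P A ->
    (entry_img P Keta_bound x c')^-1 * entry_img P Keta_bound x c =
    (entry_img P Keta_bound beta c')^-1 * entry_img P Keta_bound beta c.
  move=> hA hc hc' hb hx; rewrite /entry_img -!NV -!NM.
  apply/(coset_memP _ _ nN).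
  (* All four entries lie in one block, hence are nonzero, and the default value in [entry_img] does
     not occur. *)
  have := row_class_entry hA hc hx; have := row_class_entry hA hc' hx.
  have := row_class_entry hA hc hb; have := row_class_entry hA hc' hb.
  case E4: (P beta c') => [p4|//] _; case E3: (P beta c) => [p3|//] _.
  case E2: (P x c') => [p2|//] _; case E1: (P x c) => [p1|//] _ /=.
  have := (Keta_bound_setP _).2 (rees_trivial_entries E1 E2 E3 E4).
  by rewrite !(to_eta_groupM, to_eta_groupV).
move=> A B hA hB; split=> [c c' beta x|alpha y d d' ha hy hd hd']; first exact: rel.
(* The second family of relations is the first one multiplied by [p d alpha] on the left and by the
   inverse of [p d' y] on the right. *)
have := rel B y alpha d' d hB hy ha hd' hd; pose p := entry_img P Keta_bound.
move/(congr1 (fun u => p d alpha * u * (p d' y)^-1)); rewrite /p.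
by rewrite mulKVg !mulgA mulgK.
Qed.

Lemma Keta_sub_bound : Keta P \subset Keta_bound.
Proof.
by have [_ _] := Keta_smallest P; apply; [exact: Keta_bound_normal|exact: Keta_bound_entries].
Qed.

(** * The projection of the group onto [G_eta_star] and its kernel *)

Definition group_proj (g : gT) : G_eta_star P := coset (Keta P) (to_eta_group g).

Let nK : Keta P <| [set: eta_group gT]. Proof. by have [] := Keta_smallest P. Qed.

Lemma group_projM : {morph group_proj : a b / a * b}.
Proof. by move=> a b; rewrite /group_proj to_eta_groupM coset_normalM. Qed.

Lemma group_proj_surj h : exists g, group_proj g = h.
Proof.
have [x nx ->] := cosetP h; exists (eta_group_repr x).
by rewrite /group_proj eta_group_reprK.
Qed.

Lemma group_proj_star a b : eta_star a b -> group_proj a = group_proj b.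
Proof. by move/pi_eta_starP => e; rewrite /group_proj /to_eta_group e. Qed.

Lemma group_proj_inj a b i j :
  group_proj a = group_proj b -> eta_star (tr a i j) (tr b i j).
Proof.
move=> /(coset_memP _ _ nK) /(subsetP Keta_sub_bound).
have -> : to_eta_group a * (to_eta_group b)^-1 = to_eta_group (a * b^-1).
  by rewrite to_eta_groupM to_eta_groupV.
by move=> /Keta_bound_setP /(_ b i j); rewrite mulgKV.
Qed.

Lemma G_eta_star_lambda_rho (g h : G_eta_star P) ws :
  (1 < size ws)%N -> lambda_rho g h ws = (g, h) -> g = h.
Proof.
move=> s1 e.
have [a [b [<- <- ab]]] := eta_lift group_projM group_proj_surj s1 e.
by apply: group_proj_star; exact: eta_sub_star.
Qed.

Lemma eta_star_id_sandwich (S : semigroupType) k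
    (f : S -> rees0 (id_sandwich (G_eta_star P) k)) :
  {morph f : a b / a * b} -> forall x y, eta_star x y -> f x = f y.
Proof.
move=> fM; apply: (eta_star_morph_eq fM) => x y.
elim=> {x y} [x y [n' [n0 xy]]|x y z _ -> _ -> //].
case: n' n0 xy => [|[|n']] // _; first by move->.
case=> zs [_ e]; apply: (@id_sandwich_lambda_rho _ _ _ _ (map (omap f) zs)).
- exact: G_eta_star_lambda_rho.
- by rewrite size_map size_tuple.
set T := rees0 _; have f1M := omap_adjoin1M fM.
by rewrite (@lambda_rho_map (adjoin1 S) (adjoin1 T) _ (Some x) (Some y) zs f1M) e.
Qed.

(** * Block coordinates and the isomorphism *)

Lemma class_index :
  exists (ci : 'I_n -> 'I_(n_eta_star P)) (cj : 'I_m -> 'I_(n_eta_star P)),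
  (forall a, exists i, ci i = a) /\ (forall j i, (P j i != None) = (cj j == ci i)).
Proof.
pose cl i := [set k | col_equiv P i k].
have clE i k : (cl i == cl k) = col_equiv P i k.
  have eqR a b c : (col_equiv P c c) *
      (col_equiv P a b -> col_equiv P a c = col_equiv P b c).
    by apply: (col_equivP reg CS); rewrite inE.
  apply/eqP/idP => [e|ik].
    have : k \in cl k by rewrite inE (eqR k k k).1.
    by rewrite -e inE.
  by apply/setP => l; rewrite !inE; apply: (eqR i k l).2.
pose ci i : 'I_(n_eta_star P) := enum_rank_in (col_class_of i) (cl i).
have ciE i k : (ci i == ci k) = col_equiv P i k.
  rewrite -clE; apply/eqP/eqP => [e|e]; last first.
    rewrite /ci; apply: enum_val_inj; rewrite !enum_rankK_in ?e //; exact: col_class_of.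
  have := congr1 enum_val e.
  by rewrite /ci !enum_rankK_in //; exact: col_class_of.
(* A row gets the number of the class of any column in which it has a nonzero entry. *)
have /fin_all_exists[r rP] : forall j, exists i, P j i != None by exact: reg.1.
exists ci, (fun j => ci (r j)); split=> [a|j i].
  have /mem_col_class[i _ e] := enum_valP a.
  exists i; apply: enum_val_inj; rewrite enum_rankK_in //; exact: col_class_of.
rewrite ciE; apply/idP/existsP => [ji|[l /andP[lr li]]].
  by exists j; rewrite rP.
exact: CS lr (rP j) li.
Qed.

Lemma rees_iso : semigroup_iso (eta_quot M)
  (rees0 (id_sandwich (G_eta_star P) (n_eta_star P))).
Proof.
have [ci [cj [ciS PE]]] := class_index.
set T := rees0 (id_sandwich _ _).
have /fin_all_exists[c0 c0P] := ciS.
have /fin_all_exists[b0 b0P] : forall a, exists j, P j (c0 a) != None.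
  by move=> a; exact: reg.2.
pose p := entry_img P (Keta P).
(* Each block is normalized at its base column [c0] and base row [b0]. The first family of relations
   lets [u] be computed in row [x] instead of the base row, and the base entry then cancels. *)
pose v x := p x (c0 (cj x)).
pose u c := (p (b0 (ci c)) (c0 (ci c)))^-1 * p (b0 (ci c)) c.
have vuE x c : cj x = ci c -> v x * u c = p x c.
  move=> xc; pose A := [set k | col_equiv P c k].
  have memA k : ci k = ci c -> k \in A.
    move=> kc; rewrite inE; apply/existsP; exists x.
    by rewrite !PE kc xc eqxx.
  have mem_row y : cj y = ci c -> y \in row_class P A.
    move=> yc; rewrite inE; apply/existsP; exists c.
    by rewrite memA // PE yc eqxx.
  have hA : A \in col_classes P := col_class_of c.
  have [_ /(_ _ _ hA hA)[rel _] _] := Keta_smallest P.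
  have bc : cj (b0 (ci c)) = ci c.
    by have := b0P (ci c); rewrite PE c0P => /eqP.
  rewrite /v /u xc -(rel c (c0 (ci c)) (b0 (ci c)) x) ?mulKVg //.
  - exact: memA.
  - by apply: memA; rewrite c0P.
  - exact: mem_row.
  - exact: mem_row.
pose f (x : M) : T :=
  if x is Some (g, i, j) then Some (u i * group_proj g * v j, ci i, cj j) else None.
have fM : {morph f : x y / x * y}.
  case=> [[[g i] j]|] [[[h k] l]|] //.
  rewrite rees0_mul_tr [RHS]id_sandwich_mul.
  have := PE j k; case E: (P j k) => [pjk|] /esym; last by case: eqP.
  move/eqP => jk; rewrite jk eqxx /=; congr (Some (_, _, _)).
  rewrite !group_projM !mulgA; congr (_ * _ * _).
  by rewrite -!mulgA; congr (_ * (_ * _)); rewrite vuE // /p /entry_img E.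
have f_star := eta_star_id_sandwich fM.
apply: (@eta_quot_iso _ _ f) => //.
  case=> [[[h a] b]|]; last by exists None.
  have jb : cj (b0 b) = b by have := b0P b; rewrite PE c0P => /eqP.
  have [g gE] := group_proj_surj ((u (c0 a))^-1 * h * (v (b0 b))^-1).
  by exists (tr g (c0 a) (b0 b)); rewrite /f gE c0P jb !mulgA mulgV mul1g mulgKV.
(* Row and column moves bring both elements into the same H-class. *)
have move_to g i j k l : ci i = ci k -> cj j = cj l ->
    exists h, eta_star (tr g i j) (tr h k l).
  move=> ik jl.
  have [d [q1 Pdi]] := rees_pivot_col i.
  have [q2 Pdk] : exists q2, P d k = Some q2.
    have := PE d i; have := PE d k; rewrite Pdi ik => <-.
    by case: (P d k) => [q2|//] _; exists q2.
  have [c [q3 Pjc]] := rees_pivot_row j.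
  have [q4 Plc] : exists q4, P l c = Some q4.
    have := PE j c; have := PE l c; rewrite Pjc jl => <-.
    by case: (P l c) => [q4|//] _; exists q4.
  exists (q2^-1 * q1 * g * q3 * q4^-1).
  have := eta_star_mulr (tr g i j) (eta_sub_star (eta_rees_col Pdi Pdk)).
  rewrite !rees0_mul_tr Pdi mulVg mul1g => /eta_star_trans; apply.
  have := eta_star_mull (tr (q2^-1 * q1 * g) k j)
    (eta_sub_star (eta_rees_row Pjc Plc)).
  by rewrite !rees0_mul_tr Pjc mulgK.
case=> [[[g i] j]|] [[[h k] l]|] //; last by move=> _; exact: eta_star_refl.
move=> ff; have [e ik jl] := Some_triple_inj ff.
have [g' gg'] := move_to g i j k l ik jl.
apply: (eta_star_trans gg'); apply: group_proj_inj.
(* As [f] is constant on related pairs, [g'] and [h] have the same image between the factors [u k]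
   and [v l], which cancel. *)
have [e' _ _] := Some_triple_inj (f_star _ _ gg'); rewrite e in e'.
by apply: (mulgI (u k)); apply: (mulIg (v l)).
Qed.

End Rees.

Theorem proposition2p3 (gT : finGroupType) (n m : nat)
    (P : 'M[option gT]_(m, n)) :
  (0 < n)%N -> (0 < m)%N -> rees_regular P ->
  (~ CS_diagonal P ->
     forall q : eta_quot (rees0 P), q = (\pi_(eta_quot (rees0 P)) (rees_zero P))%qT) /\
  (CS_diagonal P ->
     semigroup_iso (eta_quot (rees0 P))
       (rees0 (id_sandwich (G_eta_star P) (n_eta_star P)))).
Proof.
move=> _ _ reg; split=> [nCS|]; last exact: rees_iso.
by elim/generic_quotient.quotW=> x; apply/pi_eta_starP; exact: eta_star_rees_not_CS.
Qed.
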